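(* Let $\Gamma\subseteq\mathbb{R}^n$ be a simple rectifiable curve with $\Gamma=\gamma([0,1])$, where $\gamma:[0,1]\to\mathbb{R}^n$ is continuous (not necessarily one-to-one). For a dissection $a=(a_0,\dots,a_k)$ of $[0,1]$ let $S(a)$ be the finite multiset $\{\gamma(a_i):0\le i\le k\}$, and let $LMST(a)$ denote a longest path inside a minimum Euclidean spanning tree of $S(a)$. Let $(a_n)_{n\in\mathbb{N}}$ be a sequence of dissections of $[0,1]$ with $\lim_{n\to\infty}\mathrm{mesh}(a_n)=0$. Then $$\lim_{n\to\infty}\mathcal{H}^1(LMST(a_n))=\mathcal{H}^1(\Gamma).$$
   Context: A curve is simple if it is the range of a one-to-one continuous map from a compact interval, and rectifiable if it has finite length. $\mathcal{H}^1$ is one-dimensional Hausdorff measure. A dissection of $[0,1]$ is a tuple $(a_0,\dots,a_k)$ with $0=a_0<a_1<\dots<a_k=1$; its mesh is $\max_i(a_{i+1}-a_i)$. A minimum Euclidean spanning tree of a finite (multi)set $S$ of points is a tree on vertex set $S$, whose edges are the straight segments between their endpoints, minimizing the total Euclidean length of the edges; a longest path inside it is a path in the tree between two vertices of maximal total Euclidean length, regarded as the union of its edge segments (any choice of minimum spanning tree and of longest path). *)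

(* Defs.v *)
From HB Require Import structures.
From mathcomp Require Import all_boot all_order all_algebra.
From mathcomp Require Import all_classical all_reals all_analysis.
Set Implicit Arguments. Unset Strict Implicit. Unset Printing Implicit Defensive.
Import Order.TTheory GRing.Theory Num.Theory.
Import numFieldNormedType.Exports.
Local Open Scope classical_set_scope.
Local Open Scope ring_scope.

Section Defs.
Variables (R : realType) (n : nat).
Notation V := 'rV[R]_n.

Definition edist (x y : V) : R :=
  Num.sqrt (\sum_(i < n) (x ord0 i - y ord0 i) ^+ 2).

Definition segment (x y : V) : set V :=
  [set (1 - t) *: x + t *: y | t in `[0, 1]].

(* Euclidean diameter (0 for the empty set, +oo if unbounded) *)
Definition diam (A : set V) : \bar R :=
  ereal_sup ([set 0%E] `|` [set r | exists x y, A x /\ A y /\ r = (edist x y)%:E]).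

Definition H1_delta (E : set V) (d : R) : \bar R :=
  ereal_inf [set (\sum_(0 <= i <oo) diam (U i))%E |
     U in [set U : nat -> set V | E `<=` \bigcup_i U i /\
                                  forall i, (diam (U i) <= d%:E)%E]].

Definition H1 (E : set V) : \bar R :=
  ereal_sup [set H1_delta E d | d in [set d : R | 0 < d]].

Definition polylen (q : seq V) : R :=
  \sum_(i < (size q).-1) edist (nth 0 q i) (nth 0 q i.+1).

Definition curve_length (g : R -> V) (a b : R) : \bar R :=
  ereal_sup [set (polylen (map g s))%:E |
     s in [set s : seq R | sorted <=%R s /\ all (fun t => t \in `[a, b]) s]].

Definition simple_rectifiable_curve (G : set V) : Prop :=
  exists (a b : R) (g : R -> V), a <= b /\
    {within `[a, b], continuous g} /\
    {in `[a, b] &, injective g} /\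
    G = g @` `[a, b] /\
    (curve_length g a b < +oo)%E.

Definition dissection (s : seq R) : Prop :=
  s != [::] /\ head 0 s = 0 /\ last 0 s = 1 /\ sorted <%R s.

Definition mesh (s : seq R) : R :=
  \big[Num.max/0]_(i < (size s).-1) (nth 0 s i.+1 - nth 0 s i).

(* ---- graphs on the vertex set 'I_N (a multiset of points P : 'I_N -> V) ---- *)
(* An edge set: pairs (u, v) with u < v, each standing for the edge {u, v}. *)
Definition edge_set (N : nat) (E : {set 'I_N * 'I_N}) : Prop :=
  forall e, e \in E -> (e.1 < e.2)%N.

Definition adj (N : nat) (E : {set 'I_N * 'I_N}) : rel 'I_N :=
  fun u v => ((u, v) \in E) || ((v, u) \in E).

Definition gconnected (N : nat) (E : {set 'I_N * 'I_N}) : Prop :=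
  forall u v : 'I_N, connect (adj E) u v.

Definition acyclic (N : nat) (E : {set 'I_N * 'I_N}) : Prop :=
  ~ exists c : seq 'I_N, [/\ uniq c, (3 <= size c)%N & cycle (adj E) c].

Definition spanning_tree (N : nat) (E : {set 'I_N * 'I_N}) : Prop :=
  [/\ edge_set E, gconnected E & acyclic E].

Definition tree_weight (N : nat) (P : 'I_N -> V) (E : {set 'I_N * 'I_N}) : R :=
  \sum_(e in E) edist (P e.1) (P e.2).

Definition is_MST (N : nat) (P : 'I_N -> V) (E : {set 'I_N * 'I_N}) : Prop :=
  spanning_tree E /\
  forall E', spanning_tree E' -> tree_weight P E <= tree_weight P E'.

Definition is_gpath (N : nat) (E : {set 'I_N * 'I_N}) (x : 'I_N) (p : seq 'I_N) :=
  path (adj E) x p /\ uniq (x :: p).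

Definition gpath_len (N : nat) (P : 'I_N -> V) (x : 'I_N) (p : seq 'I_N) : R :=
  \sum_(e <- zip (x :: p) p) edist (P e.1) (P e.2).

Definition is_longest_path (N : nat) (P : 'I_N -> V) (E : {set 'I_N * 'I_N})
    (x : 'I_N) (p : seq 'I_N) : Prop :=
  is_gpath E x p /\
  forall y q, is_gpath E y q -> gpath_len P y q <= gpath_len P x p.

Definition gpath_set (N : nat) (P : 'I_N -> V) (x : 'I_N) (p : seq 'I_N) : set V :=
  \bigcup_(e in [set e | e \in zip (x :: p) p]) segment (P e.1) (P e.2).

(* the multiset S(a) = {gamma(a_i)}, indexed by positions *)
Definition pts (g : R -> V) (s : seq R) : 'I_(size s) -> V :=
  fun i => g (nth 0 s i).

End Defs.
Arguments pts {R n} g s.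

(* Main.v *)
Require Import Defs.
From HB Require Import structures.
From mathcomp Require Import all_boot all_order all_algebra.
From mathcomp Require Import all_classical all_reals all_analysis.
From mathcomp Require Import ring lra zify.
Import Order.TTheory GRing.Theory Num.Theory.
Import numFieldNormedType.Exports.
Local Open Scope classical_set_scope.
Local Open Scope ring_scope.

(** Let g be an injective parametrization of Gamma on [a, b], of length L.
    Covering arcs by short arcs gives H1 Gamma <= L, and projecting to the line
    by the distance to an endpoint, together with additivity over separated
    sets, gives H1 Gamma >= L.  By the exchange property two edges of a minimum
    spanning tree never cross, so H1 of a path in the tree is its length.

    Upper bound: sorting the sample points along g gives a Hamiltonian path of
    length at most L, hence the tree, and any path in it, has length at most L.
    Lower bound: consecutive sample points are close, so by the bottleneck
    property all edges of the tree are short, and by uniform continuity of the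
    inverse of g they are also short in the parameter of g.  The tree path from
    a vertex near g(a) to a vertex near g(b) therefore visits, in order, a
    neighbourhood of each point of a given polygon inscribed in Gamma, and the
    longest path is at least that long. *)

(* [all_analysis] also defines an [edist]. *)
Local Notation edist := Defs.edist.

(** * Euclidean distance *)

Section Euclid.
Context {R : realType} {n : nat}.
Local Notation V := 'rV[R]_n.
Implicit Types (u v w x y z : V) (c : R).

Definition dot u v : R := \sum_(i < n) u ord0 i * v ord0 i.

Lemma dotC u v : dot u v = dot v u.
Proof. by apply: eq_bigr => i _; rewrite mulrC. Qed.

Lemma dotDl u v w : dot (u + v) w = dot u w + dot v w.
Proof. by rewrite -big_split; apply: eq_bigr => i _; rewrite mxE mulrDl. Qed.

Lemma dotZl c u v : dot (c *: u) v = c * dot u v.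
Proof. by rewrite mulr_sumr; apply: eq_bigr => i _; rewrite mxE mulrA. Qed.

Lemma dotDr u v w : dot w (u + v) = dot w u + dot w v.
Proof. by rewrite dotC dotDl !(dotC w). Qed.

Lemma dotZr c u v : dot v (c *: u) = c * dot v u.
Proof. by rewrite dotC dotZl dotC. Qed.

Lemma dot_ge0 u : 0 <= dot u u.
Proof. by apply: sumr_ge0 => i _; rewrite -expr2 sqr_ge0. Qed.

Lemma dot_eq0 u : dot u u = 0 -> u = 0.
Proof.
move=> /eqP; rewrite psumr_eq0; last by move=> i _; rewrite -expr2 sqr_ge0.
move=> /allP u0; apply/rowP => i; rewrite mxE.
by have := u0 i (mem_index_enum i); rewrite mulf_eq0 orbb => /eqP.
Qed.

(** The vector [dot v v *: u - dot u v *: v] has squared norm [dot v v] times the difference of the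
    two sides. *)
Lemma cauchy_schwarz u v : dot u v ^+ 2 <= dot u u * dot v v.
Proof.
have [v0|v0] := eqVneq (dot v v) 0.
  by rewrite v0 mulr0 (dot_eq0 _ v0) -(scale0r 0) dotZr mul0r expr2 mulr0.
have vv : 0 < dot v v by rewrite lt_neqAle eq_sym v0 dot_ge0.
rewrite -subr_ge0 -(pmulr_rge0 _ vv).
have := dot_ge0 (dot v v *: u + (- dot u v) *: v).
rewrite !(dotDl, dotDr, dotZl, dotZr) (dotC v u).
by move=> h; apply: le_trans h _; rewrite le_eqVlt; apply/orP; left; apply/eqP; ring.
Qed.

Lemma edistE x y : edist x y = Num.sqrt (dot (x - y) (x - y)).
Proof. by congr Num.sqrt; apply: eq_bigr => i _; rewrite !mxE expr2. Qed.

Lemma edist_ge0 x y : 0 <= edist x y.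
Proof. exact: sqrtr_ge0. Qed.

Lemma edist_sqr x y : edist x y ^+ 2 = dot (x - y) (x - y).
Proof. by rewrite edistE sqr_sqrtr // dot_ge0. Qed.

Lemma edistC x y : edist x y = edist y x.
Proof. by congr Num.sqrt; apply: eq_bigr => i _; rewrite -sqrrN opprB. Qed.

Lemma edistxx x : edist x x = 0.
Proof. by rewrite edistE subrr -(scale0r 0) dotZl mul0r sqrtr0. Qed.

Lemma edist_eq0 x y : edist x y = 0 -> x = y.
Proof.
move=> h; apply/eqP; rewrite -subr_eq0; apply/eqP/dot_eq0.
by rewrite -edist_sqr h expr0n.
Qed.

Lemma edist_triangle x y z : edist x z <= edist x y + edist y z.
Proof.
rewrite -[leRHS]ger0_norm ?addr_ge0 ?edist_ge0// -sqrtr_sqr [leLHS]edistE.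
apply: ler_wsqrtr; rewrite sqrrD !edist_sqr.
have -> : x - z = (x - y) + (y - z) by rewrite addrA subrK.
have := cauchy_schwarz (x - y) (y - z); rewrite -!edist_sqr -exprMn !edist_sqr.
move: (x - y) (y - z) => u v; rewrite !(dotDl, dotDr) (dotC v u) => uv.
suff : dot u v <= edist x y * edist y z by lra.
move: uv.
move=> h; apply: le_trans (ler_norm _) _; rewrite -[leLHS]sqrtr_sqr.
apply: le_trans (ler_wsqrtr h) _.
by rewrite sqrtr_sqr ger0_norm // mulr_ge0 ?edist_ge0.
Qed.

Lemma edist_continuous {T : topologicalType} (f h : T -> V) :
  continuous f -> continuous h -> continuous (fun t => edist (f t) (h t)).
Proof.
move=> cf ch t.
apply: (@continuous_comp _ _ _ (fun t => \sum_(i < n) (f t ord0 i - h t ord0 i) ^+ 2)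
  Num.sqrt); last exact: sqrt_continuous.
apply: (@continuous_big R _ +%R 0 xpredT) => [|i _ {}t]; first exact: add_continuous.
have cd : {for t, continuous (fun t => f t ord0 i - h t ord0 i)}.
  apply: cvgB.
    by apply: (@continuous_comp _ V R f (fun v => v ord0 i)); [exact: cf|exact: coord_continuous].
  by apply: (@continuous_comp _ V R h (fun v => v ord0 i)); [exact: ch|exact: coord_continuous].
exact: (cvgM cd cd).
Qed.

Definition lerp (x y : V) (t : R) : V := (1 - t) *: x + t *: y.

Lemma lerpB x y s t : lerp x y s - lerp x y t = (t - s) *: (x - y).
Proof. by apply/rowP => i; rewrite !mxE; ring. Qed.

Lemma edist_lerp x y s t : edist (lerp x y s) (lerp x y t) = `|s - t| * edist x y.
Proof.
rewrite !edistE lerpB dotZl dotZr mulrA -expr2 sqrtrM ?sqr_ge0// sqrtr_sqr.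
by rewrite distrC.
Qed.

Lemma lerp0 x y : lerp x y 0 = x.
Proof. by rewrite /lerp subr0 scale1r scale0r addr0. Qed.

Lemma lerp1 x y : lerp x y 1 = y.
Proof. by rewrite /lerp subrr scale1r scale0r add0r. Qed.

Lemma lerp_continuous x y : continuous (lerp x y).
Proof.
move=> t; apply: cvgD; apply: cvgZr_tmp; [|exact: cvg_id].
by apply: cvgB; [exact: cvg_cst|exact: cvg_id].
Qed.

(* Two edges [a b] and [c d] such that neither can be improved by an exchange
   cannot cross at an interior point [z]. *)
Lemma no_crossing (a b c d : V) s t :
  0 < s < 1 -> 0 < t < 1 -> 0 < edist a b -> 0 < edist c d ->
  edist a b <= edist a c -> edist a b <= edist a d ->
  edist c d <= edist a d -> edist c d <= edist b d ->
  lerp a b s = lerp c d t -> False.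
Proof.
move=> /andP[s0 s1] /andP[t0 t1] ab0 cd0 abac abad cdad cdbd.
set z := lerp a b s => zE.
have [az zb] : edist a z = s * edist a b /\ edist z b = (1 - s) * edist a b.
  have := edist_lerp a b 0 s; have := edist_lerp a b s 1.
  rewrite lerp0 lerp1 -/z => -> ->; split; congr (_ * _).
    by rewrite sub0r normrN gtr0_norm.
  by rewrite distrC gtr0_norm // subr_gt0.
have [cz zd] : edist c z = t * edist c d /\ edist z d = (1 - t) * edist c d.
  have := edist_lerp c d 0 t; have := edist_lerp c d t 1.
  rewrite lerp0 lerp1 -zE => -> ->; split; congr (_ * _).
    by rewrite sub0r normrN gtr0_norm.
  by rewrite distrC gtr0_norm // subr_gt0.
have abE : edist a b = edist a z + edist z b by rewrite az zb; ring.
have cdE : edist c d = edist c z + edist z d by rewrite cz zd; ring.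
have p0 : 0 < edist a z by rewrite az mulr_gt0.
have q0 : 0 < edist z d by rewrite zd mulr_gt0 // subr_gt0.
have r0 : 0 < edist z b by rewrite zb mulr_gt0 // subr_gt0.
(* The detours a-z-c and b-z-d are at least as long as the edges ab and cd, which gives both
   inequalities. *)
have rs : edist z b = edist c z.
  apply/eqP; rewrite eq_le; apply/andP; split.
    have := edist_triangle a z c; rewrite (edistC z c); lra.
  have := edist_triangle b z d; rewrite (edistC b z); lra.
have [u uD] : exists u, u = a - z by eexists.
have [w wD] : exists w, w = d - z by eexists.
have uE : dot u u = edist a z ^+ 2 by rewrite uD edist_sqr.
have wE : dot w w = edist z d ^+ 2 by rewrite wD edistC edist_sqr.
(* Since z divides cd in the ratio t : 1 - t, the vector c - z is -k times d - z. *)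
pose k := t / (1 - t).
have k0 : 0 < k by rewrite divr_gt0 // subr_gt0.
have t1' : 1 - t != 0 by rewrite subr_eq0 eq_sym lt_eqF.
have cw : c - z = - k *: w.
  rewrite wD zE; apply/rowP => i; rewrite !mxE /k; by field.
have czk : edist c z = k * edist z d by rewrite cz zd /k; field.
have acE : edist a c ^+ 2 = dot u u + k ^+ 2 * dot w w + 2 * k * dot u w.
  rewrite edist_sqr; have -> : a - c = u + k *: w.
    by rewrite -[k]opprK scaleNr -cw uD opprB addrA subrK.
  rewrite !(dotDl, dotDr, dotZl, dotZr) (dotC w u); ring.
have adE : edist a d ^+ 2 = dot u u + dot w w - 2 * dot u w.
  rewrite edist_sqr; have -> : a - d = u + (-1) *: w.
    by rewrite scaleN1r uD wD opprB addrA subrK.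
  rewrite !(dotDl, dotDr, dotZl, dotZr) (dotC w u); ring.
(* Squaring ab <= ac, with zb = cz = k zd, forces equality in Cauchy-Schwarz. So a and d lie on the
   same ray from z, and ad = |az - zd| is shorter than ab or cd. *)
have uw : edist a z * edist z d <= dot u w.
  rewrite -(ler_pM2l k0) mulrCA -czk.
  have : edist a b ^+ 2 <= edist a c ^+ 2 by rewrite ler_sqr ?nnegrE ?edist_ge0.
  rewrite acE abE uE wE -exprMn -czk rs sqrrD; lra.
have ad2 : edist a d ^+ 2 <= (edist a z - edist z d) ^+ 2.
  by rewrite adE uE wE sqrrB; lra.
have ad1 : edist a d <= `|edist a z - edist z d|.
  by rewrite -ler_sqr ?nnegrE ?edist_ge0 ?normr_ge0 // real_normK ?num_real.
case: (ger0P (edist a z - edist z d)) ad1 => _ ad1; lra.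
Qed.

End Euclid.

(** * Compactness and suprema *)

Section Modulus.
Context {R : realType}.

(** On the compact set where [psi >= e], [phi] does not vanish, so its image is closed and misses a
    ball around 0. Uniform continuity, that of an inverse, and the positive distance of disjoint
    compact arcs are all instances. *)
Lemma compact_modulus (a b c d : R) (phi psi : R * R -> R) :
  continuous phi -> continuous psi -> (forall p, 0 <= phi p) ->
  (forall p, (`[a, b] `*` `[c, d]) p -> phi p = 0 -> psi p <= 0) ->
  forall e, 0 < e -> exists2 h, 0 < h &
    forall p, (`[a, b] `*` `[c, d]) p -> phi p < h -> psi p < e.
Proof.
move=> cphi cpsi phi0 phipsi e e0.
pose K := (`[a, b] `*` `[c, d]) `&` psi @^-1` `[e, +oo[.
have cK : compact K.
  apply: compact_closedI.
    by apply: compact_setX; exact: segment_compact.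
  apply: closed_comp => [p _|]; [exact: cpsi|exact: interval_closed].
have clK : closed (phi @` K).
  apply: compact_closed; first exact: Rhausdorff.
  by apply: continuous_compact => //; exact: continuous_subspaceT.
have : nbhs (0 : R) (~` (phi @` K)).
  apply: open_nbhs_nbhs; split; first exact: closed_openC.
  move=> [p [Kp ep]] p0; have := phipsi _ Kp p0.
  by move: ep; rewrite /= in_itv /= andbT => /(lt_le_trans e0) /lt_le_trans h /h; rewrite ltxx.
move=> /nbhs_ballP[h /= h0 hK]; exists h => // p Kp ph.
rewrite ltNge; apply/negP => ep.
apply: (hK (phi p)); last first.
  by exists p => //; split => //=; rewrite in_itv /= andbT.
by rewrite /ball /= sub0r normrN ger0_norm.
Qed.

End Modulus.

Section EReal.
Context {R : realType}.
Local Open Scope ereal_scope.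

(** For finite [z], nonnegativity makes all terms finite, so each summand can be moved across the
    inequality while the supremum of the other is taken. *)
Lemma ereal_supD_le (A B : set (\bar R)) (z : \bar R) :
  A !=set0 -> B !=set0 ->
  (forall x, A x -> 0 <= x) -> (forall x, B x -> 0 <= x) ->
  (forall x y, A x -> B y -> x + y <= z) ->
  ereal_sup A + ereal_sup B <= z.
Proof.
move=> [x0 Ax0] [y0 By0] A0 B0 ABz.
case: z ABz => [z| |] ABz; last first.
- have := ABz _ _ Ax0 By0; rewrite leeNy_eq => /eqP h.
  by have := adde_ge0 (A0 _ Ax0) (B0 _ By0); rewrite h.
- by rewrite leey.
have fB y : B y -> y \is a fin_num.
  move=> By; rewrite ge0_fin_numE ?B0//.
  apply: le_lt_trans (ltry z); apply: le_trans (ABz _ _ Ax0 By).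
  by rewrite leeDr // A0.
have supA y : B y -> ereal_sup A + y <= z%:E.
  move=> By; rewrite -leeBrDr ?fB//; apply: ge_ereal_sup => x Ax.
  by rewrite leeBrDr ?fB// ABz.
have fA : ereal_sup A \is a fin_num.
  rewrite ge0_fin_numE; last first.
    by apply: le_trans (A0 _ Ax0) _; exact: ereal_sup_ubound.
  apply: le_lt_trans (ltry z); apply: le_trans (supA _ By0).
  by rewrite leeDl // B0.
rewrite -leeBrDl//; apply: ge_ereal_sup => y By.
by rewrite leeBrDl // supA.
Qed.

End EReal.

(** * Hausdorff measure *)

Section Hausdorff.
Context {R : realType} {n : nat}.
Local Notation V := 'rV[R]_n.
Implicit Types (A B E : set V) (x y z : V).
Local Open Scope ereal_scope.

Lemma diam_ge0 A : 0 <= diam A.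
Proof. by apply: ereal_sup_ubound; left. Qed.

Lemma edist_le_diam A x y : A x -> A y -> (edist x y)%:E <= diam A.
Proof. by move=> Ax Ay; apply: ereal_sup_ubound; right; exists x, y. Qed.

Lemma diam_le A (r : R) : (0 <= r)%R ->
  (forall x y, A x -> A y -> (edist x y <= r)%R) -> diam A <= r%:E.
Proof.
move=> r0 Ar; apply: ge_ereal_sup => _ [->|[x [y [Ax [Ay ->]]]]].
  by rewrite lee_fin.
by rewrite lee_fin Ar.
Qed.

Lemma diam_set0 : diam (set0 : set V) = 0.
Proof. by apply/eqP; rewrite eq_le diam_ge0 andbT; exact: diam_le. Qed.

Lemma H1_delta_ge0 E d : 0 <= H1_delta E d.
Proof. by apply: le_ereal_inf_tmp => _ [U _ <-]; apply: nneseries_ge0 => i _ _; exact: diam_ge0. Qed.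

Lemma H1_delta_anti E (d d' : R) : (d <= d')%R -> H1_delta E d' <= H1_delta E d.
Proof.
move=> dd'; apply: le_ereal_inf => _ [U [EU Ud] <-]; exists U => //; split=> // i.
by apply: le_trans (Ud i) _; rewrite lee_fin.
Qed.

Lemma H1_delta_le_H1 E (d : R) : (0 < d)%R -> H1_delta E d <= H1 E.
Proof. by move=> d0; apply: ereal_sup_ubound; exists d. Qed.

Lemma H1_ge0 E : 0 <= H1 E.
Proof. by apply: le_trans (H1_delta_le_H1 E _ (@ltr01 R)); exact: H1_delta_ge0. Qed.

Lemma le_H1 A B : A `<=` B -> H1 A <= H1 B.
Proof.
move=> AB; apply: ge_ereal_sup => _ [d d0 <-].
apply: le_trans (H1_delta_le_H1 B _ d0).
apply: le_ereal_inf => _ [U [EU Ud] <-]; exists U => //; split=> //.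
exact: subset_trans EU.
Qed.

(** A set of diameter at most h/2 cannot meet both [A] and [B], so a fine cover of the union splits
    into a cover of each, with no set counted twice. *)
Lemma H1_sep_superadditive A B (h : R) : (0 < h)%R ->
  (forall x y, A x -> B y -> (h <= edist x y)%R) -> H1 A + H1 B <= H1 (A `|` B).
Proof.
move=> h0 AB; apply: ereal_supD_le.
- by exists (H1_delta A 1), 1%R => //=.
- by exists (H1_delta B 1), 1%R => //=.
- by move=> _ [d _ <-]; exact: H1_delta_ge0.
- by move=> _ [d _ <-]; exact: H1_delta_ge0.
move=> _ _ [d1 /= d10 <-] [d2 /= d20 <-].
pose d : R := Num.min (Num.min d1 d2) (h / 2)%R.
have d0 : (0 < d)%R by rewrite !lt_min d10 d20 divr_gt0.
apply: le_trans (H1_delta_le_H1 _ _ d0).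
have dd1 : (d <= d1)%R by rewrite /d !ge_min lexx.
have dd2 : (d <= d2)%R by rewrite /d !ge_min lexx orbT.
apply: le_trans (leeD (H1_delta_anti A _ _ dd1) (H1_delta_anti B _ _ dd2)) _.
apply: le_ereal_inf_tmp => _ [U [EU Ud] <-].
(* Keep the covering sets that meet [C] and empty the others. *)
pose W (C : set V) i := if pselect (U i `&` C !=set0) then U i else set0.
have diamW C i : diam (W C i) <= diam (U i).
  by rewrite /W; case: pselect => /= _; rewrite ?diam_set0 ?diam_ge0.
have WH1 C : C `<=` A `|` B -> H1_delta C d <= \sum_(0 <= i <oo) diam (W C i).
  move=> CAB; apply: ereal_inf_lbound; exists (W C) => //; split; last first.
    by move=> i; apply: le_trans (diamW C i) (Ud i).
  move=> x Cx; have [i _ Uix] := EU _ (CAB _ Cx); exists i => //.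
  by rewrite /W; case: pselect => // -[]; exists x.
apply: le_trans (leeD (WH1 A _) (WH1 B _)) _; [exact: subsetUl|exact: subsetUr|].
rewrite -nneseriesD; [|by move=> *; exact: diam_ge0|by move=> *; exact: diam_ge0].
apply: lee_nneseries => [i _ _|i _].
  by rewrite adde_ge0 // diam_ge0.
have [[x [Ux Ax]]|NA] := pselect (U i `&` A !=set0); last first.
  by rewrite {1}/W; case: pselect => //= _; rewrite diam_set0 add0e diamW.
have [[y [Uy By]]|NB] := pselect (U i `&` B !=set0); last first.
  by rewrite {2}/W; case: pselect => //= _; rewrite diam_set0 adde0 diamW.
have := le_trans (edist_le_diam _ _ _ Ux Uy) (Ud i); rewrite lee_fin => xy.
have := AB _ _ Ax By; have : (d <= h / 2)%R by rewrite /d !ge_min lexx orbT.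
move=> *; exfalso; lra.
Qed.

(** The distance to [G a] is 1-Lipschitz and its values on the curve include all of [0, D]. A cover
    of the curve thus yields a cover of [0, D] by intervals no longer than the diameters, and
    Lebesgue measure is countably subadditive. *)
Lemma H1_curve_ge (G : R -> V) (a b : R) : (a <= b)%R -> continuous G ->
  (edist (G a) (G b))%:E <= H1 (G @` `[a, b]).
Proof.
move=> ab cG; apply: le_trans (H1_delta_le_H1 _ _ (@ltr01 R)).
apply: le_ereal_inf_tmp => _ [U [EU Ud] <-].
pose f z := edist (G a) z.
pose m i := inf (f @` U i); pose r i := fine (diam (U i)).
have rE i : (r i)%:E = diam (U i).
  rewrite fineK // ge0_fin_numE ?diam_ge0//.
  exact: le_lt_trans (Ud i) (ltry _).
have r0 i : (0 <= r i)%R by rewrite -lee_fin rE diam_ge0.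
pose D := edist (G a) (G b).
have sub : [set` `[0%R, D]] `<=` \bigcup_i [set` `[m i, (m i + r i)%R]].
  move=> t; rewrite /= in_itv /= => /andP[t0 tD].
  have [||s sab fs] := @IVT R (fun s => f (G s)) a b t ab.
  - apply: continuous_subspaceT; exact: (edist_continuous (fun=> G a) G (fun s => cvg_cst (G a)) cG).
  - by rewrite /f edistxx min_l ?max_r ?edist_ge0 // t0.
  have [i _ Ui] : (\bigcup_i U i) (G s) by apply: EU; exists s.
  exists i => //=; rewrite in_itv /= -fs; apply/andP; split.
    by apply: ge_inf; [exists 0%R => _ [z _ <-]; exact: edist_ge0|exists (G s)].
  rewrite -lerBlDr; apply: lb_le_inf; first by exists (f (G s)), (G s).
  move=> _ [z Uz <-]; rewrite lerBlDr.
  apply: le_trans (edist_triangle _ z _) _; rewrite lerD2l -lee_fin rE.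
  exact: edist_le_diam.
have : lebesgue_measure ([set` `[0%R, D]] : set R) <=
    \sum_(0 <= i <oo) lebesgue_measure ([set` `[m i, (m i + r i)%R]] : set R).
  by apply: measure_sigma_subadditive.
rewrite lebesgue_measure_itv /= lte_fin.
case: ltP => [D0|D0 _]; last first.
  apply: le_trans (nneseries_ge0 _); first by rewrite lee_fin.
  by move=> *; exact: diam_ge0.
rewrite oppr0 adde0 => h; apply: le_trans h _.
apply: lee_nneseries => [i _ _|i _]; first exact: measure_ge0.
rewrite lebesgue_measure_itv /= lte_fin -rE; case: ifP => _.
  by rewrite -EFinB lee_fin addrAC subrr add0r.
by rewrite lee_fin.
Qed.

End Hausdorff.

(** * Length and measure of arcs and polygons *)

Section Curves.
Context {R : realType} {n : nat}.
Local Notation V := 'rV[R]_n.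
Implicit Types (A B E : set V) (x y z : V) (G : R -> V).

(** Finite lists of sets in place of sequences: unions of sets then correspond to concatenation of
    covers. Beyond its end a list is padded with the empty set, of diameter 0. *)
Definition finely_covered E (L : \bar R) := forall d : R, 0 < d ->
  exists s : seq (set V), [/\ E `<=` \bigcup_i nth set0 s i,
    forall i, (diam (nth set0 s i) <= d%:E)%E &
    (\sum_(A <- s) diam A <= L)%E].

Lemma H1_finely_covered E L : finely_covered E L -> (H1 E <= L)%E.
Proof.
move=> EL; apply: ge_ereal_sup => _ [d /= d0 <-].
have [s [Es sd sL]] := EL d d0; apply: le_trans sL.
apply: ereal_inf_lbound; exists (nth set0 s); first by split.
rewrite (@nneseries_split _ _ 0%N (size s)) => [|i _]; last exact: diam_ge0.
rewrite add0n [X in (_ + X)%E]eseries0 ?adde0; first by rewrite (big_nth set0).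
by move=> i si _; rewrite nth_default // diam_set0.
Qed.

Lemma finely_coveredU E F L M : finely_covered E L -> finely_covered F M ->
  finely_covered (E `|` F) (L + M)%E.
Proof.
move=> EL FM d d0.
have [s [Es sd sL]] := EL d d0; have [t [Ft td tM]] := FM d d0.
exists (s ++ t); split; last by rewrite big_cat leeD.
- move=> x [/Es[i _ xi]|/Ft[i _ xi]].
    exists i => //; rewrite nth_cat; case: ltnP => // si.
    by move: xi; rewrite nth_default.
  by exists (size s + i)%N => //; rewrite nth_cat ltnNge leq_addr /= addKn.
- by move=> i; rewrite nth_cat; case: ifP.
Qed.

Lemma finely_covered_le E L M : (L <= M)%E ->
  finely_covered E L -> finely_covered E M.
Proof.
move=> LM EL d d0; have [s [? ? sL]] := EL d d0; exists s; split => //.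
exact: le_trans LM.
Qed.

Lemma finely_covered0 : finely_covered set0 0%E.
Proof.
move=> d d0; exists [::]; split => //; last by rewrite big_nil.
by move=> i; rewrite nth_nil diam_set0 lee_fin ltW.
Qed.

Lemma polylen_nil : polylen ([::] : seq V) = 0.
Proof. by rewrite /polylen big_ord0. Qed.

Lemma polylen1 x : polylen [:: x] = 0.
Proof. by rewrite /polylen big_ord0. Qed.

Lemma polylen_cons x y s : polylen [:: x, y & s] = edist x y + polylen (y :: s).
Proof. by rewrite /polylen /= big_ord_recl. Qed.

Lemma polylen_ge0 (s : seq V) : 0 <= polylen s.
Proof. by apply: sumr_ge0 => i _; exact: edist_ge0. Qed.

Lemma polylen_cat (s t : seq V) : polylen s + polylen t <= polylen (s ++ t).
Proof.
elim: s => [|x [|y s] IH]; first by rewrite polylen_nil add0r.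
  case: t {IH} => [|y t]; first by rewrite /= polylen1 polylen_nil addr0.
  by rewrite /= polylen_cons polylen1 add0r lerDr edist_ge0.
by rewrite /= !polylen_cons -addrA lerD2l.
Qed.

Lemma polylen_le_curve_length G (a b : R) (s : seq R) :
  sorted <=%R s -> all (fun t => t \in `[a, b]) s ->
  ((polylen (map G s))%:E <= curve_length G a b)%E.
Proof. by move=> ss sab; apply: ereal_sup_ubound; exists s. Qed.

(** Concatenating sorted lists in [a, c] and [c, b] gives a sorted list in [a, b]; the joining edge
    only adds length. *)
Lemma curve_length_superadditive G (a c b : R) : a <= c -> c <= b ->
  (curve_length G a c + curve_length G c b <= curve_length G a b)%E.
Proof.
move=> ac cb; apply: ereal_supD_le.
- by exists (polylen (map G [::]))%:E, [::].
- by exists (polylen (map G [::]))%:E, [::].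
- by move=> _ [s _ <-]; rewrite lee_fin polylen_ge0.
- by move=> _ [s _ <-]; rewrite lee_fin polylen_ge0.
move=> _ _ [s [ss sac] <-] [t [st tcb] <-].
rewrite -EFinD; apply: (@le_trans _ _ (polylen (map G (s ++ t)))%:E).
  by rewrite lee_fin map_cat polylen_cat.
apply: polylen_le_curve_length.
  rewrite (sorted_pairwise le_trans) pairwise_cat -!(sorted_pairwise le_trans) ss st !andbT.
  apply/allrelP => u v /(allP sac) + /(allP tcb).
  by rewrite !in_itv /= => /andP[_ uc] /andP[cv _]; exact: le_trans cv.
rewrite all_cat; apply/andP; split; apply/allP => u.
  by move=> /(allP sac); rewrite !in_itv /= => /andP[-> uc]; rewrite (le_trans uc).
by move=> /(allP tcb); rewrite !in_itv /= => /andP[cu ->]; rewrite (le_trans ac).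
Qed.

(** Two points of the arc, in parameter order, are already an inscribed polygon. *)
Lemma diam_curve G (a b : R) : (diam (G @` `[a, b]) <= curve_length G a b)%E.
Proof.
apply: ge_ereal_sup => _ [->|[_ [_ [[s sab <-] [[t tab <-] ->]]]]].
  by have := @polylen_le_curve_length G a b [::] isT isT; rewrite /= polylen_nil.
wlog st : s t sab tab / s <= t.
  by move=> W; case: (leP s t) => [|/ltW] ?; [|rewrite edistC]; exact: W.
have := @polylen_le_curve_length G a b [:: s; t].
by rewrite /= polylen_cons polylen1 addr0 !andbT; apply => //; apply/andP.
Qed.

Lemma edist_pair_continuous (F G : R -> V) : continuous F -> continuous G ->
  continuous (fun p : R * R => edist (F p.1) (G p.2)).
Proof.
move=> cF cG; apply: edist_continuous => p.
  by apply: (@continuous_comp _ _ _ fst F); [exact: cvg_fst|exact: cF].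
by apply: (@continuous_comp _ _ _ snd G); [exact: cvg_snd|exact: cG].
Qed.

Lemma curve_unif_continuous G (a b : R) : continuous G ->
  forall e, 0 < e -> exists2 h, 0 < h &
    {in `[a, b] &, forall s t, `|s - t| < h -> edist (G s) (G t) < e}.
Proof.
move=> cG e e0.
have [| | | |h h0 H] := @compact_modulus R a b a b
  (fun p => `|p.1 - p.2|) (fun p => edist (G p.1) (G p.2)) _ _ _ _ e e0.
- move=> p; apply: cvg_norm; apply: cvgB; [exact: cvg_fst|exact: cvg_snd].
- exact: edist_pair_continuous.
- by [].
- by move=> p _ /eqP; rewrite normr_eq0 subr_eq0 => /eqP ->; rewrite edistxx.
by exists h => // s t sab tab; exact: (H (s, t)).
Qed.

(** The two distances of [curve_unif_continuous] change roles; injectivity makes equal points have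
    equal parameters. *)
Lemma curve_inv_unif_continuous G (a b : R) : continuous G ->
  {in `[a, b] &, injective G} ->
  forall e, 0 < e -> exists2 h, 0 < h &
    {in `[a, b] &, forall s t, edist (G s) (G t) < h -> `|s - t| < e}.
Proof.
move=> cG Ginj e e0.
have [| | | |h h0 H] := @compact_modulus R a b a b
  (fun p => edist (G p.1) (G p.2)) (fun p => `|p.1 - p.2|) _ _ _ _ e e0.
- exact: edist_pair_continuous.
- move=> p; apply: cvg_norm; apply: cvgB; [exact: cvg_fst|exact: cvg_snd].
- by move=> p; exact: edist_ge0.
- by move=> p [p1 p2] /edist_eq0/Ginj ->//; rewrite subrr normr0.
by exists h => // s t sab tab; exact: (H (s, t)).
Qed.

(** Arcs of parameter length at most h/2 have diameter at most [d] by uniform continuity, and each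
    diameter is at most the length of its arc. These lengths sum to at most that of the curve. *)
Lemma finely_covered_curve G (a b : R) : a <= b -> continuous G ->
  finely_covered (G @` `[a, b]) (curve_length G a b).
Proof.
move=> ab cG d d0; have [h h0 Gh] := curve_unif_continuous G a b cG d d0.
have small u v : a <= u -> v <= b -> v - u <= h / 2 ->
    (diam (G @` `[u, v]) <= d%:E)%E.
  move=> au vb uv; apply: diam_le; first exact: ltW.
  move=> _ _ [s sI <-] [t tI <-]; apply/ltW/Gh.
  - by move: sI; rewrite /= !in_itv /=; lra.
  - by move: tI; rewrite /= !in_itv /=; lra.
  by move: sI tI; rewrite /= !in_itv /= ltr_norml; lra.
(* Induction on the number of steps of length h/2 that suffice to reach [b]. *)
suff H : forall (N : nat) (u : R), a <= u -> u <= b -> b - u <= N%:R * (h / 2) ->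
    exists s : seq (set V), [/\ G @` `[u, b] `<=` \bigcup_i nth set0 s i,
    forall i, (diam (nth set0 s i) <= d%:E)%E &
    (\sum_(A <- s) diam A <= curve_length G u b)%E].
  apply: (H (Num.bound ((b - a) / (h / 2)))) => //.
  rewrite -ler_pdivrMr ?divr_gt0//; apply/ltW/archi_boundP.
  by rewrite !divr_ge0 ?subr_ge0 // ltW.
have one (u : R) : a <= u -> b - u <= h / 2 ->
    exists s : seq (set V), [/\ G @` `[u, b] `<=` \bigcup_i nth set0 s i,
    forall i, (diam (nth set0 s i) <= d%:E)%E &
    (\sum_(A <- s) diam A <= curve_length G u b)%E].
  move=> au uh; exists [:: G @` `[u, b]]; split.
  - by move=> x xG; exists 0%N.
  - by case=> [|[|i]] /=; rewrite ?small // diam_set0 lee_fin ltW.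
  - by rewrite big_seq1 diam_curve.
elim=> [|N IH] u au ub uN.
  by apply: one => //; move: uN; rewrite mul0r; lra.
have [uh|uh] := leP (b - u) (h / 2); first exact: one.
pose c := u + h / 2.
have [| | |s [sc sd sL]] := IH c; rewrite /c; [lra|lra| |].
  by move: uN; rewrite -addn1 natrD mulrDl mul1r; lra.
exists (G @` `[u, c] :: s); split.
- move=> _ [t tI <-]; case: (leP t c) => tc.
    by exists 0%N => //=; exists t => //; move: tI; rewrite /= !in_itv /= => /andP[-> _].
  have [|i _ ti] := sc (G t); last by exists i.+1.
  by exists t => //; move: tI; rewrite /= !in_itv /= => /andP[_ ->]; rewrite ltW.
- by case=> [|i] //=; apply: small => //; rewrite /c; lra.
- rewrite big_cons; apply: le_trans (curve_length_superadditive G u c b _ _).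
  + by apply: leeD => //; exact: diam_curve.
  + by rewrite /c; lra.
  + by rewrite /c; lra.
Qed.

Lemma le_path_last (t : R) (s : seq R) : path <=%R t s ->
  {in t :: s, forall u, u <= last t s}.
Proof.
elim: s t => [|v s IH] t /=; first by move=> _ u; rewrite inE => /eqP ->.
move=> /andP[tv vs] u; rewrite in_cons => /predU1P[->|]; last exact: IH.
by apply: le_trans tv _; apply: IH => //; exact: mem_head.
Qed.

(** Induction on the polygon. The first arc touches the remaining one at [G u], so it is stopped at
    [u - k]: injectivity then separates the two arcs, and the first edge loses less than [e]. *)
Lemma polylen_le_H1 G (a b : R) (t : R) (s : seq R) : continuous G ->
  {in `[a, b] &, injective G} ->
  sorted <=%R (t :: s) -> all (fun t => t \in `[a, b]) (t :: s) ->
  ((polylen (map G (t :: s)))%:E <= H1 (G @` `[t, last t s]))%E.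
Proof.
move=> cG Ginj; elim: s t => [|u s IH] t; first by rewrite /= polylen1 H1_ge0.
move=> /=/andP[tu us] /andP[tab usab'].
have usab : all (fun t => t \in `[a, b]) (u :: s) by [].
clear usab'.
have {}IH := IH u us usab; rewrite polylen_cons.
have ul : u <= last u s.
  by apply: le_path_last => //; exact: mem_head.
have lab : last u s \in `[a, b] by apply: (allP usab); exact: mem_last.
have uab : u \in `[a, b] by apply: (allP usab); exact: mem_head.
move: tu; rewrite le_eqVlt => /predU1P[->|tu].
  by rewrite edistxx add0r.
apply/lee_addgt0Pr => e e0.
have [h h0 Gh] := curve_unif_continuous G a b cG e e0.
(* The bound h/2 puts [G (u - k)] within [e] of [G u]; the bound [u - t] keeps [u - k] at or after
   [t]. *)
pose k := Num.min (h / 2) (u - t).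
have k0 : 0 < k by rewrite lt_min divr_gt0 //= subr_gt0.
have kh : k <= h / 2 by rewrite ge_min lexx.
have ku : k <= u - t by rewrite ge_min lexx orbT.
have ukab : u - k \in `[a, b].
  by move: uab tab; rewrite !in_itv /=; lra.
(* Parameters at least [k] apart give points at least [eta] apart. *)
have [eta eta0 Geta] := curve_inv_unif_continuous G a b cG Ginj k k0.
have sep : ((edist (G t) (G (u - k)))%:E + H1 (G @` `[u, last u s]) <=
    H1 (G @` `[t, last u s]))%E.
  have tuk : t <= u - k by lra.
  apply: le_trans (leeD (H1_curve_ge G t (u - k) tuk cG) (lexx _)) _.
  apply: le_trans (H1_sep_superadditive _ _ eta eta0 _) _.
    move=> _ _ [v vI <-] [w wI <-]; rewrite leNgt; apply/negP => vw.
    move: vI wI lab tab uab; rewrite /= !in_itv /= => vI wI lab' tab' uab'.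
    have vab : v \in `[a, b] by rewrite in_itv /=; lra.
    have wab : w \in `[a, b] by rewrite in_itv /=; lra.
    by have := Geta v w vab wab vw; rewrite ltr_norml; lra.
  apply: le_H1 => _ [[v vI <-]|[v vI <-]]; exists v => //;
    move: vI; rewrite /= !in_itv /=; lra.
have Guk : edist (G (u - k)) (G u) < e.
  by apply: Gh => //; rewrite addrAC subrr add0r normrN gtr0_norm //; lra.
have tri := edist_triangle (G t) (G (u - k)) (G u).
rewrite EFinD addeC.
apply: le_trans (leeD IH (_ : _ <= (edist (G t) (G (u - k)))%:E + e%:E)%E) _.
  by rewrite -EFinD lee_fin; lra.
by rewrite addeA leeD // addeC.
Qed.

Lemma H1_arc G (a b : R) : a <= b -> continuous G ->
  {in `[a, b] &, injective G} -> H1 (G @` `[a, b]) = curve_length G a b.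
Proof.
move=> ab cG Ginj; apply/eqP; rewrite eq_le; apply/andP; split.
  exact: H1_finely_covered (finely_covered_curve G a b ab cG).
apply: ge_ereal_sup => _ [[|t s] [ss sab] <-]; first by rewrite /= polylen_nil H1_ge0.
apply: le_trans (polylen_le_H1 G a b t s cG Ginj ss sab) _; apply: le_H1.
move=> _ [u uI <-]; exists u => //.
have := allP sab _ (mem_last t s); have := allP sab _ (mem_head t s).
by move: uI; rewrite /= !in_itv /=; lra.
Qed.

(** * Measure of finite unions of segments *)

Section Segments.
Context {I : eqType} (f h : I -> V).

Lemma bigcup_in_nil (F : I -> set V) : \bigcup_(c in [set` [::]]) F c = set0.
Proof. by apply/seteqP; split => // z []. Qed.

Lemma bigcup_in_cons (F : I -> set V) e (l : seq I) :
  \bigcup_(c in [set` e :: l]) F c = F e `|` \bigcup_(c in [set` l]) F c.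
Proof.
apply/seteqP; split => z.
  move=> [c /=]; rewrite in_cons => /predU1P[->|cl] Fz; first by left.
  by right; exists c.
move=> [Fz|[c /= cl Fz]]; first by exists e => //=; rewrite mem_head.
by exists c => //=; rewrite in_cons cl orbT.
Qed.

(** The edges of a polygon inscribed in a segment telescope. *)
Lemma curve_length_lerp x y : (curve_length (lerp x y) 0 1 <= (edist x y)%:E)%E.
Proof.
apply: ge_ereal_sup => _ [s [ss s01] <-]; rewrite lee_fin.
suff H : forall t r, path <=%R t r ->
    polylen (map (lerp x y) (t :: r)) = (last t r - t) * edist x y.
  case: s ss s01 => [|t s] ss s01; first by rewrite /= polylen_nil edist_ge0.
  rewrite H // ler_piMl ?edist_ge0//.
  have := allP s01 _ (mem_last t s); have := allP s01 _ (mem_head t s).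
  by rewrite !in_itv /=; lra.
move=> t r; elim: r t => [|u r IH] t /=; first by rewrite polylen1 subrr mul0r.
move=> /andP[tu ur]; rewrite polylen_cons -/(map _ (u :: r)) IH // edist_lerp.
by rewrite ler0_norm ?subr_le0 //; ring.
Qed.

Lemma H1_segments_le (l : seq I) :
  (H1 (\bigcup_(e in [set` l]) segment (f e) (h e)) <=
   (\sum_(e <- l) edist (f e) (h e))%:E)%E.
Proof.
apply: H1_finely_covered; elim: l => [|e l IH].
  by rewrite big_nil bigcup_in_nil; exact: finely_covered0.
rewrite big_cons EFinD bigcup_in_cons; apply: finely_coveredU => //.
apply: finely_covered_le (curve_length_lerp _ _) _.
exact: finely_covered_curve ler01 (lerp_continuous _ _).
Qed.

(** Edges of a path share endpoints. Trimming both ends leaves compact pieces that can be disjoint,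
    hence at positive distance. *)
Definition shrunk (k : R) (e : I) : set V := lerp (f e) (h e) @` `[k, 1 - k].

Lemma H1_shrunk_ge (l : seq I) (k : R) : 0 < k -> k < 1 / 2 -> uniq l ->
  {in l &, forall e e', e != e' -> shrunk k e `&` shrunk k e' = set0} ->
  ((\sum_(e <- l) (1 - 2 * k) * edist (f e) (h e))%:E <=
   H1 (\bigcup_(e in [set` l]) shrunk k e))%E.
Proof.
move=> k0 k2; elim: l => [|e l IH] /=; first by rewrite big_nil H1_ge0.
move=> /andP[el ul] disj.
have {}IH : ((\sum_(e <- l) (1 - 2 * k) * edist (f e) (h e))%:E <=
   H1 (\bigcup_(e in [set` l]) shrunk k e))%E.
  by apply: IH => // c c' cl cl'; apply: disj; rewrite in_cons ?cl ?cl' orbT.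
rewrite big_cons EFinD bigcup_in_cons.
(* The distance from the first piece to the others is bounded below by a minimum over the list,
   found by an inner induction. *)
have [eta eta0 Heta] : exists2 eta, 0 < eta & forall x y, shrunk k e x ->
    (\bigcup_(e in [set` l]) shrunk k e) y -> eta <= edist x y.
  have : {in l, forall e', shrunk k e `&` shrunk k e' = set0}.
    move=> e' e'l; apply: disj; rewrite ?mem_head// ?in_cons ?e'l ?orbT//.
    by apply: contraNneq el => ->.
  elim: l {el ul IH disj} => [|e' l IH] disj.
    by exists 1 => // x y _; rewrite bigcup_in_nil.
  have [e1 e10 H1'] : exists2 eta, 0 < eta & forall x y, shrunk k e x ->
    (\bigcup_(e in [set` l]) shrunk k e) y -> eta <= edist x y.
    by apply: IH => c cl; apply: disj; rewrite in_cons cl orbT.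
  (* With [psi] constantly 1 and tolerance 1, the conclusion for a distance below [e2] is the absurd
     1 < 1, so [e2] bounds the distance from below. *)
  have [| | | |e2 e20 H2] := @compact_modulus R k (1 - k) k (1 - k)
    (fun p => edist (lerp (f e) (h e) p.1) (lerp (f e') (h e') p.2))
    (fun=> 1) _ _ _ _ 1 ltr01.
  - by apply: (edist_pair_continuous (lerp (f e) (h e)) (lerp (f e') (h e')));
      exact: lerp_continuous.
  - by move=> p; exact: cvg_cst.
  - by move=> p; exact: edist_ge0.
  - move=> p [p1 p2] /edist_eq0 pE; exfalso.
    suff : (shrunk k e `&` shrunk k e') (lerp (f e) (h e) p.1).
      by rewrite disj // mem_head.
    by split; [exists p.1|exists p.2].
  exists (Num.min e1 e2); first by rewrite lt_min e10.
  move=> x y ex; rewrite bigcup_in_cons => -[e'y|ly]; rewrite ge_min.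
    apply/orP; right; rewrite leNgt; apply/negP.
    by case: ex e'y => s sI <- [t tI <-] => /(H2 (s, t) (conj sI tI)); rewrite ltxx.
  by rewrite (H1' _ _ ex ly).
apply: le_trans (H1_sep_superadditive _ _ eta eta0 Heta); apply: leeD => //.
have kk : k <= 1 - k by lra.
apply: le_trans (H1_curve_ge _ k (1 - k) kk (lerp_continuous (f e) (h e))).
rewrite edist_lerp lee_fin ler_wpM2r ?edist_ge0//.
by rewrite distrC ger0_norm; lra.
Qed.

Lemma H1_segments_ge (l : seq I) : uniq l ->
  {in l &, forall e e', e != e' -> 0 < edist (f e) (h e) ->
    0 < edist (f e') (h e') -> forall s t, 0 < s < 1 -> 0 < t < 1 ->
    lerp (f e) (h e) s <> lerp (f e') (h e') t} ->
  ((\sum_(e <- l) edist (f e) (h e))%:E <=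
   H1 (\bigcup_(e in [set` l]) segment (f e) (h e)))%E.
Proof.
move=> ul disj; set S := \sum_(e <- l) _.
have S0 : 0 <= S by apply: sumr_ge0 => e _; exact: edist_ge0.
(* Sample points may coincide. Edges of length 0 add nothing to the sum and are dropped, since
   disjointness is known only for edges of positive length. *)
pose l' := [seq e <- l | 0 < edist (f e) (h e)].
have SE : S = \sum_(e <- l') edist (f e) (h e).
  rewrite big_filter big_mkcond; apply: eq_bigr => e _; case: ifPn => //.
  by rewrite -leNgt => h0; apply/eqP; rewrite eq_le h0 edist_ge0.
apply/lee_addgt0Pr => e e0.
(* The first bound keeps [k] below 1/2, the second makes the trimmed length [2 * k * S] at most [e];
   [S + 1] avoids dividing by 0. *)
pose k := Num.min (1 / 4) (e / (2 * (S + 1))).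
have S1 : 0 < S + 1 by lra.
have k0 : 0 < k by rewrite lt_min; apply/andP; split; [lra|rewrite divr_gt0 // mulr_gt0].
have k4 : k <= 1 / 4 by rewrite ge_min lexx.
have kS : 2 * k * S <= e.
  have : k <= e / (2 * (S + 1)) by rewrite ge_min lexx orbT.
  rewrite ler_pdivlMr ?mulr_gt0// => kk; apply: le_trans kk.
  rewrite mulrDr mulr1 mulrDr; lra.
have k2 : k < 1 / 2 by lra.
have := H1_shrunk_ge l' k k0 k2 (filter_uniq _ ul); rewrite -mulr_sumr -SE => H.
have {}H : ((S * (1 - 2 * k))%:E <= H1 (\bigcup_(e in [set` l]) segment (f e) (h e)))%E.
  rewrite mulrC; apply: le_trans (H _) (le_H1 _ _ _).
    move=> c c'; rewrite !mem_filter => /andP[c0 cl] /andP[c'0 c'l] cc'.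
    apply/seteqP; split => // z [[s /= sI sz] [t /= tI tz]].
    apply: (disj c c' cl c'l cc' c0 c'0 s t); rewrite ?sz ?tz//.
      by move: sI; rewrite in_itv /=; lra.
    by move: tI; rewrite in_itv /=; lra.
  move=> z [c /=]; rewrite mem_filter => /andP[_ cl] [s sI sz]; exists c => //.
  by exists s => //; move: sI; rewrite /= !in_itv /=; lra.
apply: le_trans (leeD H (lexx e%:E)).
by rewrite -EFinD lee_fin; lra.
Qed.

End Segments.

End Curves.

(** * Spanning trees *)

Section Graphs.
Context {N : nat}.
Implicit Types (E : {set 'I_N * 'I_N}) (u v w x y : 'I_N) (p : seq 'I_N).

(** The form in which an edge set stores the edge joining two distinct vertices: smaller index
    first. *)
Definition ordp u v := if (u < v)%N then (u, v) else (v, u).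

Fixpoint path_edges x p :=
  if p is y :: p' then ordp x y :: path_edges y p' else [::].

Lemma adj_sym E : symmetric (adj E).
Proof. by move=> u v; rewrite /adj orbC. Qed.

Lemma connect_adj_sym E : connect_sym (adj E).
Proof. exact/sym_connect_sym/adj_sym. Qed.

Lemma ordpC u v : ordp u v = ordp v u.
Proof.
rewrite /ordp; case: ltngtP => // uv.
by rewrite (val_inj uv).
Qed.

Lemma ordp_lt u v : u != v -> ((ordp u v).1 < (ordp u v).2)%N.
Proof.
rewrite /ordp; case: (ltnP u v) => //= vu uv.
by rewrite ltn_neqAle vu andbT eq_sym.
Qed.

Lemma adj_ordp E u v : ordp u v \in E -> adj E u v.
Proof. by rewrite /ordp /adj; case: ifP => _ ->; rewrite ?orbT. Qed.

Lemma ordp_adj E u v : edge_set E -> adj E u v -> ordp u v \in E.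
Proof.
move=> EE /orP[] uv; have := EE _ uv; rewrite /ordp /= => lt; first by rewrite lt.
by rewrite ltnNge ltnW.
Qed.

Lemma adj_neq E u v : edge_set E -> adj E u v -> u != v.
Proof.
by move=> EE /orP[] uv; have := EE _ uv; rewrite /= ltn_neqAle => /andP[]; rewrite // eq_sym.
Qed.

Lemma connect_adj_sub E E' :
  (forall u v, adj E u v -> connect (adj E') u v) ->
  forall u v, connect (adj E) u v -> connect (adj E') u v.
Proof. by move=> EE' u v; exact: connect_sub. Qed.

Lemma adj_setD1 E u v x y : adj E x y -> x != u -> y != u -> adj (E :\ ordp u v) x y.
Proof.
move=> + xu yu; have ne a b : a != u -> b != u -> (a, b) != ordp u v.
  by move=> au bu; rewrite /ordp; case: ifP => _;
    rewrite xpair_eqE negb_and ?au ?bu ?orbT.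
by rewrite /adj !in_setD1 !ne.
Qed.

Lemma adj_setD1_cases E u v x y : adj E x y ->
  adj (E :\ ordp u v) x y \/ (x = u /\ y = v) \/ (x = v /\ y = u).
Proof.
rewrite /adj !in_setD1.
have [xy|xy] /= := eqVneq (x, y) (ordp u v).
  by right; move: xy; rewrite /ordp; case: ifP => _ [-> ->]; [left|right].
have [yx|yx] /= := eqVneq (y, x) (ordp u v); last by left.
by right; move: yx; rewrite /ordp; case: ifP => _ [-> ->]; [right|left].
Qed.

(* An edge lying on a cycle can be removed without disconnecting the graph. *)
Lemma gconnected_spanning_tree E : edge_set E -> gconnected E ->
  exists2 T : {set 'I_N * 'I_N}, T \subset E & spanning_tree T.
Proof.
have [m] := ubnP #|E|; elim: m E => // m IH E Em EE Ec.
have [ac|] := pselect (acyclic E); first by exists E.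
move=> /contrapT[c [uc sc cc]].
case: c uc sc cc => [//|x [//|y [//|z s]]] uc _ /= /and3P[xy yz zx].
pose E1 := E :\ ordp x y.
have E1E : E1 \subset E by exact: finset.subD1set.
have eE : ordp x y \in E by exact: ordp_adj.
move: uc; rewrite /= !in_cons !negb_or => /and3P[/and3P[nxy nxz nxs] /andP[nyz nys] _].
(* The rest of the cycle joins y to x through z. Its first edge yz avoids x and its later edges
   avoid y, so none of them is the removed edge. *)
have xy1 : connect (adj E1) x y.
  rewrite connect_adj_sym; apply/connectP; exists (z :: rcons s x); last by rewrite /= last_rcons.
  rewrite /E1 ordpC /=; apply/andP; split.
    rewrite ordpC; apply: adj_setD1; rewrite // eq_sym //.
  apply: (@sub_in_path _ (predC1 y) (adj E)) zx.
    by move=> a b /= ay bY ab; exact: adj_setD1.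
  rewrite /= eq_sym nyz all_rcons /= nxy /=; apply/allP => a al /=.
  by apply: contraNneq nys => <-.
have [|||T TE1 TT] := IH E1.
- by move: Em; rewrite (cardsD1 (ordp x y) E) eE add1n ltnS.
- by move=> e eE1; apply: EE; exact: (fintype.subsetP E1E).
- move=> u v; apply: (connect_adj_sub E) => // a b /(adj_setD1_cases _ x y)[|[]].
  + exact: connect1.
  + by case=> -> ->.
  + by case=> -> ->; rewrite connect_adj_sym.
by exists T => //; exact: fintype.subset_trans E1E.
Qed.

(** Follow a walk from [u] to [w]: a step either survives the removal or lands on [u] or [v]. *)
Lemma connect_setD1 E u v : gconnected E ->
  forall w, connect (adj (E :\ ordp u v)) u w || connect (adj (E :\ ordp u v)) v w.
Proof.
move=> Ec w; set F := E :\ _.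
have step a b : adj E a b -> connect (adj F) u a || connect (adj F) v a ->
    connect (adj F) u b || connect (adj F) v b.
  move=> /(adj_setD1_cases _ u v)[ab|[[_ ->]|[_ ->]]]; last 2 first.
  - by rewrite connect0 orbT.
  - by rewrite connect0.
  by case/orP => h; rewrite (connect_trans h (connect1 ab)) ?orbT.
have walk p a : connect (adj F) u a || connect (adj F) v a -> path (adj E) a p ->
    connect (adj F) u (last a p) || connect (adj F) v (last a p).
  elim: p a => [//|b p IH] a ua /= /andP[ab]; exact: IH (step _ _ ab ua).
have /connectP[p up ->] := Ec u w.
by apply: walk up; rewrite connect0.
Qed.

Lemma path_edges_mem x p e : e \in path_edges x p -> (e.1 \in x :: p) && (e.2 \in x :: p).
Proof.
elim: p x => [//|y p IH] x; rewrite [path_edges _ _]/= in_cons => /orP[/eqP->|/IH].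
  by rewrite /ordp; case: ifP => _ /=; rewrite !in_cons !eqxx ?orbT.
by move=> /andP[h1 h2]; rewrite in_cons h1 orbT in_cons h2 orbT.
Qed.

Lemma path_edges_uniq x p : uniq (x :: p) -> uniq (path_edges x p).
Proof.
elim: p x => [//|y p IH] x /andP[xp /IH up]; rewrite [path_edges _ _]/= cons_uniq up andbT.
apply: contra xp => /path_edges_mem; rewrite /ordp.
by case: ifP => _ /= /andP[].
Qed.

Lemma path_edges_sub E x p : edge_set E -> path (adj E) x p -> {subset path_edges x p <= E}.
Proof.
move=> EE; elim: p x => [//|y p IH] x /= /andP[xy yp] e.
by rewrite in_cons => /orP[/eqP ->|]; [exact: ordp_adj|exact: IH].
Qed.

Lemma path_edges_path E x p : {subset path_edges x p <= E} -> path (adj E) x p.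
Proof.
elim: p x => [//|y p IH] x /= h; apply/andP; split.
  by apply: adj_ordp; apply: h; rewrite mem_head.
by apply: IH => e ep; apply: h; rewrite in_cons ep orbT.
Qed.

Lemma path_edges_edge_set x p : uniq (x :: p) -> edge_set [set e in path_edges x p].
Proof.
move=> up e; rewrite inE; elim: p x up => [//|y p IH] x /andP[xp up].
rewrite [path_edges _ _]/= in_cons => /orP[/eqP->|]; last exact: IH.
by move: xp; rewrite in_cons negb_or => /andP[xy _]; exact: ordp_lt.
Qed.

End Graphs.

(** * Minimum spanning trees *)

Section MST.
Context {R : realType} {n N : nat}.
Local Notation V := 'rV[R]_n.
Variable P : 'I_N -> V.
Implicit Types (E : {set 'I_N * 'I_N}) (u v w x y : 'I_N) (p : seq 'I_N).

Lemma len_ordp u v : edist (P (ordp u v).1) (P (ordp u v).2) = edist (P u) (P v).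
Proof. by rewrite /ordp; case: ifP => //= _; rewrite edistC. Qed.

Lemma tree_weight_sub E E' : E \subset E' -> tree_weight P E <= tree_weight P E'.
Proof.
move=> EE'; rewrite /tree_weight [leRHS](big_setID E) /= (finset.setIidPr EE') lerDl.
by apply: sumr_ge0 => e _; exact: edist_ge0.
Qed.

(** A connected graph contains a spanning tree, and edge lengths are nonnegative. Exchanges
    therefore need only preserve connectedness. *)
Lemma MST_le_connected E E' : is_MST P E -> edge_set E' -> gconnected E' ->
  tree_weight P E <= tree_weight P E'.
Proof.
move=> [_ Emin] EE' cE'; have [T TE' /Emin h] := gconnected_spanning_tree E' EE' cE'.
exact: le_trans (tree_weight_sub _ _ TE').
Qed.

(** Replacing the edge uv by xy keeps the graph connected, because u still reaches v through x and
    y; minimality compares the two lengths. *)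
Lemma MST_exchange E u v x y : is_MST P E -> ordp u v \in E ->
  connect (adj (E :\ ordp u v)) u x -> connect (adj (E :\ ordp u v)) y v ->
  edist (P u) (P v) <= edist (P x) (P y).
Proof.
move=> mE; have [[EE Ec _] _] := mE; set F := E :\ ordp u v => eE ux yv.
(* Loops are not edges; when [x = y] the graph [F] is already connected. *)
pose G := if x == y then F else ordp x y |: F.
have FG : F \subset G by rewrite /G; case: eqP => // _; exact: finset.subsetUr.
have FE : F \subset E by exact: finset.subD1set.
have conF a b : connect (adj F) a b -> connect (adj G) a b.
  apply: connect_adj_sub => c d cd; apply: connect1; move: cd.
  by rewrite /adj => /orP[] /(fintype.subsetP FG) ->; rewrite ?orbT.
have uv : connect (adj G) u v.
  apply: connect_trans (conF _ _ ux) _; apply: connect_trans (conF _ _ yv).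
  rewrite /G; case: eqP => [->|_]; first exact: connect0.
  by apply: connect1; apply: adj_ordp; rewrite finset.setU11.
have EG : edge_set G.
  have EF e : e \in F -> (e.1 < e.2)%N by move=> /(fintype.subsetP FE); exact: EE.
  rewrite /G; case: eqP => // /eqP xy e; rewrite finset.in_setU1 => /orP[/eqP->|]; last exact: EF.
  exact: ordp_lt.
have := MST_le_connected E G mE EG.
rewrite {1}/tree_weight (big_setD1 _ eE) /= len_ordp => h.
have {h} : edist (P u) (P v) + tree_weight P F <= tree_weight P G.
  apply: h => a b; apply: (connect_adj_sub E) => // c d /(adj_setD1_cases _ u v)[cd|[]].
  - by apply: conF; exact: connect1.
  - by case=> -> ->.
  - by case=> -> ->; rewrite connect_adj_sym.
move=> h; rewrite -(lerD2r (tree_weight P F)); apply: le_trans h _.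
rewrite /G; case: eqP => [->|_]; first by rewrite edistxx add0r.
(* If xy is already an edge of [F], adding it changes nothing and the inequality only becomes
   weaker. *)
have [xyF|xyF] := boolP (ordp x y \in F).
  have -> : ordp x y |: F = F by apply/finset.setUidPr; rewrite finset.sub1set.
  by rewrite lerDr edist_ge0.
by rewrite {1}/tree_weight big_setU1 //= len_ordp.
Qed.

Lemma edge_ordp E e : edge_set E -> e \in E -> e = ordp e.1 e.2.
Proof. by case: e => u v EE /EE; rewrite /ordp /= => ->. Qed.

Lemma MST_bottleneck E (eta : R) : is_MST P E -> 0 <= eta ->
  (forall i j : 'I_N, j = i.+1 :> nat -> edist (P i) (P j) <= eta) ->
  forall u v, adj E u v -> edist (P u) (P v) <= eta.
Proof.
move=> mE eta0 step u v; have [[EE Ec _] _] := mE.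
wlog uv : u v / (u < v)%N => [W|] uvE.
  have := adj_neq _ _ _ EE uvE; case: (ltngtP u v) => [uv _|vu _|/val_inj -> /eqP//].
    exact: W.
  by rewrite edistC; apply: W => //; rewrite adj_sym.
have eE := ordp_adj _ _ _ EE uvE; set F := E :\ ordp u v.
have [//|far] := leP (edist (P u) (P v)) eta; exfalso.
have H k (w : 'I_N) : w = (u + k)%N :> nat -> connect (adj F) u w.
  elim: k w => [|k IH] w wk.
    by have -> : w = u by apply: val_inj; rewrite /= wk addn0.
  have kN : (u + k < N)%N by apply: leq_ltn_trans (ltn_ord w); rewrite wk leq_add2l.
  have h := IH (Ordinal kN) erefl.
  have /orP[//|vw] := connect_setD1 _ u v Ec w.
  have : edist (P u) (P v) <= edist (P (Ordinal kN)) (P w).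
    by apply: (MST_exchange E) => //; rewrite connect_adj_sym.
  move=> le1; have := step (Ordinal kN) w; rewrite /= wk addnS => /(_ erefl) le2.
  by have := lt_le_trans far (le_trans le1 le2); rewrite ltxx.
have uvF : connect (adj F) u v by apply: (H (v - u)%N); rewrite subnKC // ltnW.
(* Exchange against the degenerate pair (v, v), of length 0. *)
have := MST_exchange _ _ _ _ _ mE eE uvF (connect0 _ v).
by rewrite edistxx => /(lt_le_trans (le_lt_trans eta0 far)); rewrite ltxx.
Qed.

(** Once ab is removed, cd lies wholly on one side; joining the endpoint of ab on the other side to
    c or to d is a valid exchange. *)
Lemma MST_exchange_edge E a b c d : is_MST P E -> ordp a b \in E -> ordp c d \in E ->
  ordp a b != ordp c d ->
  (edist (P a) (P b) <= edist (P a) (P c) /\ edist (P a) (P b) <= edist (P a) (P d)) \/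
  (edist (P a) (P b) <= edist (P b) (P c) /\ edist (P a) (P b) <= edist (P b) (P d)).
Proof.
move=> mE eE fE ef; have [[EE Ec _] _] := mE; set F := E :\ ordp a b.
have cd : connect (adj F) c d.
  by apply/connect1/adj_ordp; rewrite in_setD1 eq_sym ef.
have ex x y : connect (adj F) a x -> connect (adj F) b y ->
    edist (P a) (P b) <= edist (P x) (P y).
  by move=> ax yb; apply: (MST_exchange E) => //; rewrite connect_adj_sym.
have /orP[ac|bc] := connect_setD1 _ a b Ec c; [right|left].
  have ad := connect_trans ac cd.
  by rewrite ![edist (P b) _]edistC; split; apply: ex.
by split; apply: ex => //; exact: connect_trans bc cd.
Qed.

Lemma lerp_rev (x y : V) (s : R) : lerp x y s = lerp y x (1 - s).
Proof. by apply/rowP => i; rewrite !mxE; ring. Qed.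

Lemma MST_no_crossing E e f s t : is_MST P E -> e \in E -> f \in E -> e != f ->
  0 < edist (P e.1) (P e.2) -> 0 < edist (P f.1) (P f.2) ->
  0 < s < 1 -> 0 < t < 1 ->
  lerp (P e.1) (P e.2) s <> lerp (P f.1) (P f.2) t.
Proof.
case: e f => [a b] [c d] mE eE fE ef /= ab0 cd0 s01 t01 zE.
have [[EE _ _] _] := mE.
have eO := edge_ordp _ _ EE eE; have fO := edge_ordp _ _ EE fE; rewrite /= in eO fO.
rewrite eO in eE ef; rewrite fO in fE ef.
have s01' : 0 < 1 - s < 1 by lra.
have t01' : 0 < 1 - t < 1 by lra.
have ba0 : 0 < edist (P b) (P a) by rewrite edistC.
have dc0 : 0 < edist (P d) (P c) by rewrite edistC.
have := MST_exchange_edge _ _ _ _ _ mE eE fE ef.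
rewrite eq_sym in ef.
have := MST_exchange_edge _ _ _ _ _ mE fE eE ef.
move: (edistC (P a) (P b)) (edistC (P c) (P d)) (edistC (P a) (P c)) (edistC (P a) (P d))
  (edistC (P b) (P c)) (edistC (P b) (P d)) => ? ? ? ? ? ?.
(* In each case, reversing one or both edges as needed gives the four inequalities of
   [no_crossing]. *)
move=> [[c1 c2]|[d1 d2]] [[a1 a2]|[b1 b2]].
- by apply: (@no_crossing _ _ (P a) (P b) (P d) (P c) s (1 - t)) => //; rewrite -?lerp_rev //; lra.
- by apply: (@no_crossing _ _ (P b) (P a) (P d) (P c) (1 - s) (1 - t)) => //; rewrite -?lerp_rev //; lra.
- by apply: (@no_crossing _ _ (P a) (P b) (P c) (P d) s t) => //; lra.
- by apply: (@no_crossing _ _ (P b) (P a) (P c) (P d) (1 - s) t) => //; rewrite -?lerp_rev //; lra.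
Qed.

(** * Length and measure of paths in a minimum spanning tree *)

Lemma gpath_len_cons x y p :
  gpath_len P x (y :: p) = edist (P x) (P y) + gpath_len P y p.
Proof. by rewrite /gpath_len /= big_cons. Qed.

Lemma gpath_len_nil x : gpath_len P x [::] = 0.
Proof. by rewrite /gpath_len big_nil. Qed.

Lemma gpath_len_cat x p q :
  gpath_len P x (p ++ q) = gpath_len P x p + gpath_len P (last x p) q.
Proof.
elim: p x => [|y p IH] x; first by rewrite gpath_len_nil add0r.
by rewrite /= !gpath_len_cons IH addrA.
Qed.

Lemma edist_le_gpath_len x p : edist (P x) (P (last x p)) <= gpath_len P x p.
Proof.
elim: p x => [|y p IH] x; first by rewrite /= edistxx gpath_len_nil.
rewrite gpath_len_cons /=; apply: le_trans (edist_triangle _ (P y) _) _.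
by rewrite lerD2l.
Qed.

Lemma gpath_len_ge0 x p : 0 <= gpath_len P x p.
Proof. exact: le_trans (edist_ge0 _ _) (edist_le_gpath_len x p). Qed.

Lemma gpath_len_polylen x p : gpath_len P x p = polylen (map P (x :: p)).
Proof.
elim: p x => [|y p IH] x; first by rewrite gpath_len_nil /= polylen1.
by rewrite gpath_len_cons IH /= polylen_cons.
Qed.

Lemma gpath_len_edges x p :
  gpath_len P x p = \sum_(e <- path_edges x p) edist (P e.1) (P e.2).
Proof.
elim: p x => [|y p IH] x; first by rewrite gpath_len_nil big_nil.
by rewrite gpath_len_cons /= big_cons IH len_ordp.
Qed.

Lemma segmentC (a b : V) : segment a b = segment b a.
Proof.
suff H : forall c d : V, segment c d `<=` segment d c by apply/seteqP; split; exact: H.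
move=> c d _ [t /= tI <-]; exists (1 - t); first by move: tI; rewrite /= !in_itv /=; lra.
exact: (esym (lerp_rev c d t)).
Qed.

Lemma gpath_set_edges x p :
  gpath_set P x p = \bigcup_(e in [set` path_edges x p]) segment (P e.1) (P e.2).
Proof.
elim: p x => [|y p IH] x; first by rewrite /gpath_set !bigcup_in_nil.
rewrite [path_edges _ _]/= bigcup_in_cons -IH /gpath_set /= bigcup_in_cons /=.
by congr (_ `|` _); rewrite /ordp; case: ifP => //= _; exact: segmentC.
Qed.

Lemma gpath_len_le_weight E x p : edge_set E -> is_gpath E x p ->
  gpath_len P x p <= tree_weight P E.
Proof.
move=> EE [pp up]; rewrite gpath_len_edges.
have ul := path_edges_uniq _ _ up; have sub := path_edges_sub _ _ _ EE pp.
have -> : \sum_(e <- path_edges x p) edist (P e.1) (P e.2) =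
    tree_weight P [set e in path_edges x p].
  rewrite big_uniq // /tree_weight; apply: eq_bigl => e; by rewrite inE.
by apply: tree_weight_sub; apply/fintype.subsetP => e; rewrite inE; exact: sub.
Qed.

(** The edges of a path through all vertices form a connected graph. *)
Lemma MST_le_hamiltonian E x p : is_MST P E -> uniq (x :: p) ->
  (forall u, u \in x :: p) -> tree_weight P E <= gpath_len P x p.
Proof.
move=> mE up all_in; pose F := [set e in path_edges x p].
have pF : path (adj F) x p by apply: path_edges_path => e; rewrite inE.
have -> : gpath_len P x p = tree_weight P F.
  rewrite gpath_len_edges big_uniq ?path_edges_uniq // /tree_weight.
  by apply: eq_bigl => e; rewrite inE.
apply: MST_le_connected => //; first exact: path_edges_edge_set.
move=> u v; have xc w : connect (adj F) x w by apply: (path_connect pF).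
by apply: connect_trans (xc v); rewrite connect_adj_sym.
Qed.

Lemma H1_gpath_set E x p : is_MST P E -> is_gpath E x p ->
  H1 (gpath_set P x p) = (gpath_len P x p)%:E.
Proof.
move=> mE [pp up]; have [[EE _ _] _] := mE.
have ul := path_edges_uniq _ _ up; have sub := path_edges_sub _ _ _ EE pp.
rewrite gpath_set_edges gpath_len_edges; apply/eqP; rewrite eq_le; apply/andP; split.
  exact: (H1_segments_le (fun e => P e.1) (fun e => P e.2)).
apply: (H1_segments_ge (fun e => P e.1) (fun e => P e.2)) => //.
move=> e f /sub eE /sub fE ef e0 f0 s t s01 t01.
exact: (MST_no_crossing E).
Qed.

End MST.

(** * Longest paths and dissections *)

Section Dissections.
Context {R : realType}.
Implicit Types (s : seq R) (t : R).

Lemma mesh_ge0 s : 0 <= mesh s.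
Proof. exact: bigmax_ge_id. Qed.

Lemma mesh_step s i : (i.+1 < size s)%N -> nth 0 s i.+1 - nth 0 s i <= mesh s.
Proof.
move=> si; have i1 : (i < (size s).-1)%N by lia.
exact: (@le_bigmax _ _ _ 0 (fun i : 'I_(size s).-1 => nth 0 s i.+1 - nth 0 s i) (Ordinal i1)).
Qed.

Lemma dissection_mono s i j : dissection s -> (i <= j < size s)%N ->
  nth 0 s i <= nth 0 s j.
Proof.
move=> [_ [_ [_ ss]]] /andP[ij js].
apply: (sorted_leq_nth le_trans lexx) => //.
- by apply: sub_sorted ss => u v /ltW.
- by rewrite inE; exact: leq_ltn_trans js.
Qed.

Lemma dissection_itv s i : dissection s -> (i < size s)%N -> nth 0 s i \in `[0, 1].
Proof.
move=> ds si; have [_ [s0 [s1 _]]] := ds.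
have ss : (0 < size s)%N by lia.
rewrite in_itv /=; apply/andP; split.
  by rewrite -[X in X <= _]s0 -nth0; apply: dissection_mono => //; lia.
have <- : last 0 s = 1 by [].
by rewrite -nth_last; apply: dissection_mono => //; rewrite ltn_predL ss andbT -ltnS prednK.
Qed.

Lemma dissection_near s t : dissection s -> t \in `[0, 1] ->
  exists i : 'I_(size s), `|nth 0 s i - t| <= mesh s.
Proof.
move=> ds; have [sn [s0 [s1 ss]]] := ds; rewrite in_itv /= => /andP[t0 t1].
have ss0 : (0 < size s)%N by rewrite lt0n size_eq0.
have ex : exists i, (i < size s)%N && (t <= nth 0 s i).
  exists (size s).-1; rewrite nth_last s1 t1 andbT; lia.
(* Take the first dissection point at or after [t]; its predecessor lies before [t], so it is within
   one mesh of [t]. At index 0 the point is 0 itself. *)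
case: (ex_minnP ex) => i /andP[si ti] imin; exists (Ordinal si) => /=.
rewrite ger0_norm ?subr_ge0 //.
case: i si ti imin => [|i] si ti imin.
  by rewrite nth0 s0 sub0r; apply: le_trans (mesh_ge0 s); rewrite oppr_le0.
apply: le_trans (mesh_step _ _ si); rewrite lerD2l lerN2.
rewrite leNgt; apply/negP => it.
have := imin i; rewrite (ltW it) (ltnW si) => /(_ isT); lia.
Qed.

End Dissections.

(** * Vertex paths with small parameter steps *)

Section Chains.
Context {R : realType} {n N : nat}.
Local Notation V := 'rV[R]_n.
Variables (P : 'I_N -> V) (G : R -> V) (tau : 'I_N -> R).
Implicit Types (x y : 'I_N) (p q : seq 'I_N).

Let close (th : R) : rel 'I_N := fun u v => `|tau u - tau v| <= th.

(** A discrete intermediate value argument: steps of size at most [th] cannot jump over the window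
    of radius [th] around [c]. *)
Lemma chain_visits (th c : R) x p : path (close th) x p ->
  tau x <= c + th -> c - th <= tau (last x p) ->
  exists p1 p2, p = p1 ++ p2 /\ `|tau (last x p1) - c| <= th.
Proof.
elim: p x => [|y p IH] x /=.
  by move=> _ xc cx; exists [::], [::]; split=> //=; rewrite ler_norml; lra.
move=> /andP[xy yp] xc cl; have [cx|xc'] := leP (c - th) (tau x).
  by exists [::], (y :: p); split=> //=; rewrite ler_norml; lra.
have [|p1 [p2 [-> H]]] := IH y yp _ cl.
  by move: xy; rewrite /close ler_norml; lra.
by exists (y :: p1), p2.
Qed.

(** The path is cut successively at vertices near the corners of the polygon. Each piece is at least
    as long as the corresponding polygon edge, up to an error [e] at either end. *)
Lemma chain_len_ge (th e : R) (t : R) (s : seq R) x p :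
  path (close th) x p -> sorted <=%R (t :: s) -> `|tau x - t| <= th ->
  {in s, forall u, u - th <= tau (last x p)} ->
  {in t :: s, forall u i, `|tau i - u| <= th -> edist (P i) (G u) <= e} ->
  polylen (map G (t :: s)) - (size s)%:R * (2 * e) <= gpath_len P x p.
Proof.
elim: s t x p => [|u s IH] t x p xp.
  by move=> *; rewrite /= polylen1 mul0r subr0 gpath_len_ge0.
move=> /= /andP[tu us] xt far near.
have [||p1 [p2 [pE yu]]] := @chain_visits th u x p xp.
- by move: xt; rewrite ler_norml; lra.
- by apply: far; rewrite mem_head.
move: xp far; rewrite pE cat_path last_cat => /andP[_ yp2] far.
have {}IH : polylen (map G (u :: s)) - (size s)%:R * (2 * e) <=
    gpath_len P (last x p1) p2.
  apply: IH => //.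
  - by move=> v vs; apply: far; rewrite in_cons vs orbT.
  - by move=> v vs; apply: near; rewrite in_cons vs orbT.
rewrite gpath_len_cat polylen_cons.
have xy := edist_le_gpath_len P x p1; set y := last x p1 in xy yu IH *.
have Gt := near t (mem_head _ _) x xt.
have Gu : edist (P y) (G u) <= e by apply: near => //; rewrite !in_cons eqxx orbT.
have t1 := edist_triangle (G t) (P x) (G u).
have t2 := edist_triangle (P x) (P y) (G u).
rewrite (edistC (G t) (P x)) in t1.
rewrite /= in IH; rewrite -natr1 mulrDl mul1r; lra.
Qed.

Hypothesis PG : forall i, P i = G (tau i).

Lemma MST_weight_le (a b : R) E : (forall i, tau i \in `[a, b]) ->
  (0 < N)%N -> is_MST P E -> ((tree_weight P E)%:E <= curve_length G a b)%E.
Proof.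
move=> tauab N0 mE; pose r : rel 'I_N := fun i j => tau i <= tau j.
pose o := sort r (enum 'I_N).
have ou : uniq o by rewrite sort_uniq enum_uniq.
have oall i : i \in o by rewrite mem_sort mem_enum.
have rs : sorted r o by apply: sort_sorted => i j; exact: le_total.
have os : sorted <=%R (map tau o) by rewrite sorted_map.
case: o ou oall os {rs} => [|y q] ou oall os; first by have := oall (Ordinal N0).
apply: (@le_trans _ _ (gpath_len P y q)%:E).
  by rewrite lee_fin; exact: MST_le_hamiltonian.
have -> : gpath_len P y q = polylen (map G (map tau (y :: q))).
  by rewrite gpath_len_polylen -map_comp; congr polylen; exact: eq_map.
apply: polylen_le_curve_length => //.
by apply/allP => _ /mapP[i _ ->].
Qed.

End Chains.

(** * Lower bound for the longest path, and the limit *)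

Section Main.
Context {R : realType} {n : nat}.
Local Notation V := 'rV[R]_n.

(** Clamping the parameter to the interval extends the curve by constants, so that the other lemmas
    can assume continuity on the whole line. *)
Lemma continuous_extension (a b : R) (g : R -> V) : a <= b ->
  {within `[a, b], continuous g} ->
  exists2 G, continuous G & {in `[a, b], G =1 g}.
Proof.
move=> ab /subspace_continuousP gc; pose cl t := Num.max a (Num.min b t).
have clI t : `[a, b]%classic (cl t).
  by rewrite /= in_itv /= le_max lexx /= ge_max ab ge_min lexx.
have clc : continuous cl.
  move=> t; apply: continuous_max; first exact: cvg_cst.
  by apply: continuous_min; [exact: cvg_cst|exact: cvg_id].
exists (g \o cl) => [t|t].
  move=> W /(gc _ (clI t)) /(clc t).
  by move=> H; refine (@filterS R (nbhs t) _ _ _ _ H) => u Hu; exact: Hu (clI u).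
rewrite in_itv /= => /andP[ta tb]; rewrite /= /cl (min_idPr tb).
by rewrite (max_idPr ta).
Qed.

Lemma longest_path_ge (a b : R) (G : R -> V) (gam : R -> V) (L : R) :
  a <= b -> continuous G -> {in `[a, b] &, injective G} -> continuous gam ->
  G @` `[a, b] = gam @` `[0, 1] -> curve_length G a b = L%:E ->
  forall e, 0 < e -> exists2 d, 0 < d & forall s, dissection s -> mesh s < d ->
    forall E x p, is_MST (pts gam s) E -> is_longest_path (pts gam s) E x p ->
    L - e <= gpath_len (pts gam s) x p.
Proof.
move=> ab cG Ginj cgam Ggam LE e e0.
have : ((L - e / 2)%:E < curve_length G a b)%E by rewrite LE lte_fin; lra.
move=> /ereal_sup_gt[_ [[|t r] [rs rab] <-]]; rewrite lte_fin => rL.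
  (* An empty polygon has length 0, so [L - e] is negative and any mesh bound will do. *)
  exists 1 => // s _ _ E x p _ _; apply: le_trans (gpath_len_ge0 _ _ _).
  by move: rL; rewrite /= polylen_nil; lra.
(* Chosen so that the total error over the polygon edges is at most e/2; the other half of [e] is
   spent on the choice of polygon. *)
pose e1 := e / 2 / (2 * ((size r)%:R + 1)).
have r0 : 0 <= (size r)%:R :> R by [].
have e10 : 0 < e1 by rewrite divr_gt0 ?mulr_gt0 //; lra.
have e1E : (size r)%:R * (2 * e1) <= e / 2.
  have -> : e / 2 = ((size r)%:R + 1) * (2 * e1).
    rewrite /e1; field; lra.
  by rewrite ler_wpM2r ?mulr_ge0 ?(ltW e10) //; lra.
(* The tolerances are chosen backwards: [d] for the mesh gives sample distances below eta/2, these
   give parameter gaps below th/2, and these give distances below [e1]. *)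
have [th th0 Hth] := curve_unif_continuous G a b cG e1 e10.
have th20 : 0 < th / 2 by lra.
have [eta eta0 Heta] := curve_inv_unif_continuous G a b cG Ginj _ th20.
have eta20 : 0 < eta / 2 by lra.
have [d d0 Hd] := curve_unif_continuous gam 0 1 cgam _ eta20.
exists d => // s ds sd E x p mE [_ longest].
pose P := pts gam s.
have tauP i : exists u, u \in `[a, b] /\ G u = P i.
  have : (gam @` `[0, 1]) (P i).
    by exists (nth 0 s i) => //; exact: dissection_itv.
  by rewrite -Ggam => -[u uab uG]; exists u.
(* The parameter of each sample point on the injective arc, where the order of visits makes
   sense. *)
pose tau i := projT1 (cid (tauP i)).
have tauab i : tau i \in `[a, b] by rewrite /tau; case: cid => u [].
have PG i : P i = G (tau i) by rewrite /tau; case: cid => u [].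
have near c : c \in `[a, b] -> exists i, `|tau i - c| <= th / 2.
  move=> cab; have : (gam @` `[0, 1]) (G c) by rewrite -Ggam; exists c.
  move=> [w wI wG]; have [i iw] := dissection_near s w ds wI.
  exists i; apply/ltW/Heta => //; rewrite -PG -wG.
  apply: (@lt_trans _ _ (eta / 2)); last by lra.
  apply: Hd => //; first by exact: dissection_itv.
  exact: le_lt_trans sd.
have tab : t \in `[a, b] by apply: (allP rab); exact: mem_head.
have lab : last t r \in `[a, b] by apply: (allP rab); exact: mem_last.
have [u ut] := near t tab; have [v vl] := near _ lab.
have [[EE Ec _] _] := mE.
have step i j : adj E i j -> `|tau i - tau j| <= th / 2.
  move=> ij; apply/ltW/Heta => //; rewrite -!PG.
  apply: (@le_lt_trans _ _ (eta / 2)); last by lra.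
  apply: (MST_bottleneck _ _ (eta / 2) mE (ltW eta20)) ij => k l lk.
  apply/ltW/Hd; [exact: dissection_itv|exact: dissection_itv|].
  apply: le_lt_trans sd; rewrite distrC lk ger0_norm; last first.
    by rewrite subr_ge0; apply: dissection_mono => //; rewrite leqnSn -lk ltn_ord.
  by apply: mesh_step; rewrite -lk ltn_ord.
(* The tree joins a vertex near the first corner to one near the last; the joining walk, shortened
   to a simple path, is no longer than the longest path. *)
have /connectP[q0 uq0 vq0] := Ec u v.
case: (shortenP uq0) vq0 => q uq uniq_q _ vq.
have := longest u q (conj uq uniq_q); apply: le_trans.
have qclose : path (fun i j => `|tau i - tau j| <= th / 2) u q.
  by apply: sub_path uq => i j; exact: step.
have := @chain_len_ge R n _ P G tau (th / 2) e1 t r u q qclose rs ut.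
move=> H; have {}H := H _ _.
apply: le_trans (H _ _); first by lra.
- move=> c cr; rewrite -vq.
  have : c <= last t r by apply: le_path_last; rewrite // in_cons cr orbT.
  by move: vl; rewrite ler_norml; lra.
- move=> c cr i ic; rewrite PG; apply/ltW/Hth => //.
    exact: (allP rab).
  by apply: le_lt_trans ic _; lra.
Qed.

End Main.

Theorem theorem4p10 (R : realType) (n : nat) (Gamma : set 'rV[R]_n)
    (gamma : R -> 'rV[R]_n) (a : nat -> seq R) :
  simple_rectifiable_curve Gamma ->
  {within `[0, 1], continuous gamma} ->
  Gamma = gamma @` `[0, 1] ->
  (forall m, dissection (a m)) ->
  mesh (a m) @[m --> \oo] --> 0 ->
  forall (T : forall m, {set 'I_(size (a m)) * 'I_(size (a m))})
         (x : forall m, 'I_(size (a m)))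
         (p : forall m, seq 'I_(size (a m))),
  (forall m, is_MST (pts gamma (a m)) (T m)) ->
  (forall m, is_longest_path (pts gamma (a m)) (T m) (x m) (p m)) ->
  H1 (gpath_set (pts gamma (a m)) (x m) (p m)) @[m --> \oo] --> H1 Gamma.
Proof.
move=> [c [d [g [cd [gc [ginj [Gg glen]]]]]]] gamc Ggam da mesh0 T x p mT lp.
have [G cG Geq] := continuous_extension c d g cd gc.
have [gam cgam gameq] := continuous_extension 0 1 gamma ler01 gamc.
have ptsE m : pts gam (a m) = pts gamma (a m).
  by apply/funext => i; apply: gameq; exact: dissection_itv.
have GE : Gamma = G @` `[c, d].
  by rewrite Gg; apply: eq_imagel => t tI; rewrite Geq.
have gamE : Gamma = gam @` `[0, 1].
  by rewrite Ggam; apply: eq_imagel => t tI; rewrite gameq.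
have Ginj : {in `[c, d] &, injective G}.
  by move=> s t sI tI; rewrite !Geq //; exact: ginj.
have lenE : curve_length G c d = curve_length g c d.
  congr ereal_sup; apply: eq_imagel => s [_ sI]; congr (polylen _)%:E.
  by apply/eq_in_map => t /(allP sI); exact: Geq.
pose L := fine (curve_length G c d).
have LE : curve_length G c d = L%:E.
  rewrite fineK // ge0_fin_numE lenE //.
  by apply: le_trans (diam_ge0 _) (diam_curve g c d).
have H1E m : H1 (gpath_set (pts gamma (a m)) (x m) (p m)) =
    (gpath_len (pts gamma (a m)) (x m) (p m))%:E.
  by apply: (H1_gpath_set _ (T m)) => //; have [] := lp m.
rewrite GE (H1_arc G c d cd cG Ginj) LE.
under eq_fun do rewrite H1E.
apply: cvg_EFin; first by near=> m.
apply/cvgrPdist_le => e e0 /=.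
have [h h0 H] := longest_path_ge c d G gam L cd cG Ginj cgam (etrans (esym GE) gamE) LE e e0.
(* This bound holds for every [m]; only the lower bound needs a small mesh. *)
have upper m : gpath_len (pts gamma (a m)) (x m) (p m) <= L.
  have [path_xp _] := lp m; have [[EE _ _] _] := mT m.
  apply: le_trans (gpath_len_le_weight _ _ _ _ EE path_xp) _.
  rewrite -lee_fin -LE.
  have tauP i : exists u, u \in `[c, d] /\ G u = pts gamma (a m) i.
    have : (gam @` `[0, 1]) (pts gamma (a m) i).
      by rewrite -ptsE; exists (nth 0 (a m) i) => //; exact: dissection_itv.
    by rewrite -gamE GE => -[u ucd uG]; exists u.
  pose tau i := projT1 (cid (tauP i)).
  apply: (MST_weight_le _ G tau) => // [i|i|].
  - by rewrite /tau; case: cid => u [].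
  - by rewrite /tau; case: cid => u [].
  - exact: leq_ltn_trans (ltn_ord (x m)).
near=> m.
rewrite ger0_norm ?subr_ge0 ?upper //.
have mh : mesh (a m) < h.
  by near: m; exact: (cvgr_lt _ mesh0).
have := H (a m) (da m) mh (T m) (x m) (p m); rewrite ptsE.
by move=> /(_ (mT m) (lp m)); lra.
Unshelve. all: by end_near.
Qed.
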